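(* Let $F$ be a field and $\lambda\in F$. There are no simple finite-dimensional $\lambda$-double Lie algebras over $F$.
   Context: A double bracket on a vector space $V$ over $F$ is a linear map $V\otimes V\to V\otimes V$, $a\otimes b\mapsto\{\!\{a,b\}\!\}$. For $u\in V^{\otimes n}$ and $\sigma\in S_n$, $u^\sigma$ denotes $u$ with tensor factors permuted by $\sigma$ (so $(x\otimes y)^{(12)}=y\otimes x$, $(x\otimes y\otimes z)^{(12)}=y\otimes x\otimes z$, $(x\otimes y\otimes z)^{(23)}=x\otimes z\otimes y$). Put, extended linearly, $\{\!\{a,b\otimes c\}\!\}_L=\{\!\{a,b\}\!\}\otimes c$, $\{\!\{a,b\otimes c\}\!\}_R=b\otimes\{\!\{a,c\}\!\}$, $\{\!\{a\otimes b,c\}\!\}_L=(\{\!\{a,c\}\!\}\otimes b)^{(23)}$. A $\lambda$-double Lie algebra ($\lambda\in F$) is a vector space $V$ with a double bracket such that for all $a,b,c\in V$: $$\{\!\{a,b\}\!\}+\{\!\{b,a\}\!\}^{(12)}=\lambda(a\otimes b-b\otimes a),$$ $$\{\!\{a,\{\!\{b,c\}\!\}\}\!\}_L-\{\!\{b,\{\!\{a,c\}\!\}\}\!\}_R-\{\!\{\{\!\{a,b\}\!\},c\}\!\}_L=-\lambda(b\otimes\{\!\{a,c\}\!\})^{(12)}.$$ An ideal of $V$ is a subspace $I\subseteq V$ with $\{\!\{V,I\}\!\}+\{\!\{I,V\}\!\}\subseteq I\otimes V+V\otimes I$. $V$ is simple if $\{\!\{V,V\}\!\}\neq(0)$ and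 $V$ has no nonzero proper ideals.
   Formalization: Assumes that λ = 0 when F has characteristic 2: in characteristic 2 with λ ≠ 0 the claim fails, since V = Fe with {{e,e}} = λ e⊗e is a simple one-dimensional λ-double Lie algebra. *)

(* Defs.v *)
From HB Require Import structures.
From mathcomp Require Import all_boot all_order all_algebra.

Set Implicit Arguments.
Unset Strict Implicit.
Unset Printing Implicit Defensive.

Import GRing.Theory.
Import VectorInternalTheory.
Local Open Scope ring_scope.

(* The tensor product of two finite-dimensional spaces is realised by the
   matrices of coordinates with respect to the canonical coordinate maps
   v2r : U -> 'rV_(dim U), so that u (x) v is the rank one matrix
   (v2r u)^T *m v2r v.  Lemmas tens_linear_l, tens_linear_r, tliftE and
   tens_ext below are its universal property. *)
Definition tensor (F : fieldType) (U W : vectType F) : vectType F :=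
  'M[F]_(dim U, dim W).

Definition tens (F : fieldType) (U W : vectType F) (u : U) (w : W)
  : tensor U W := (v2r u)^T *m v2r w.

Notation "u '\ox' w" := (tens u w)
  (at level 40, left associativity) : ring_scope.

Definition stdbase (F : fieldType) (U : vectType F) (i : 'I_(dim U)) : U :=
  r2v (delta_mx 0 i).

(* For bilinear f, the unique linear map with u \ox w |-> f u w. *)
Definition tlift (F : fieldType) (U W X : vectType F) (f : U -> W -> X)
    (t : tensor U W) : X :=
  \sum_i \sum_j (t : 'M_(_, _)) i j *: f (stdbase i) (stdbase j).

Section UniversalProperty.

Variables (F : fieldType) (U W X : vectType F).

Lemma tens_linear_l (w : W) : linear (fun u : U => u \ox w).
Proof. by move=> a u v; rewrite /tens !linearP /= mulmxDl -scalemxAl. Qed.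

Lemma tens_linear_r (u : U) : linear (fun w : W => u \ox w).
Proof. by move=> a v w; rewrite /tens linearP mulmxDr -scalemxAr. Qed.

Lemma tlift_linear (f : U -> W -> X) : linear (tlift f).
Proof.
move=> a s t; rewrite /tlift scaler_sumr -big_split; apply: eq_bigr => i _.
rewrite scaler_sumr -big_split; apply: eq_bigr => j _ /=.
by rewrite !mxE scalerDl scalerA.
Qed.

Lemma stdbase_sum (T : vectType F) (u : T) :
  u = \sum_i v2r u 0 i *: stdbase i.
Proof.
rewrite -[LHS]v2rK [X in r2v X]row_sum_delta linear_sum /=.
by apply: eq_bigr => i _; rewrite linearZ.
Qed.

Lemma tliftE (f : U -> W -> X) :
    (forall w, linear (f^~ w)) -> (forall u, linear (f u)) ->
  forall u w, tlift f (u \ox w) = f u w.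
Proof.
move=> fl fr u w.
pose gl w := GRing.isLinear.Build F U X _ (f^~ w) (fl w).
pose Gl w : {linear U -> X} := HB.pack (f^~ w) (gl w).
pose gr u := GRing.isLinear.Build F W X _ (f u) (fr u).
pose Gr u : {linear W -> X} := HB.pack (f u) (gr u).
rewrite [in RHS](stdbase_sum u) -[RHS]/(Gl w _) linear_sum /=.
apply: eq_bigr => i _; rewrite -[f _ w]/(Gl w _) linearZ /= .
rewrite -[f _ w]/(Gr _ w) [in RHS](stdbase_sum w) linear_sum scaler_sumr.
apply: eq_bigr => j _; rewrite linearZ /= scalerA; congr (_ *: _).
by rewrite /tens mxE big_ord1 mxE.
Qed.

Lemma tens_stdbase i j :
  (@stdbase F U i) \ox (@stdbase F W j) = delta_mx i j :> 'M_(_, _).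
Proof. by rewrite /tens /stdbase !r2vK trmx_delta mul_delta_mx. Qed.

Lemma tens_ext (g h : {linear tensor U W -> X}) :
  (forall u w, g (u \ox w) = h (u \ox w)) -> g =1 h.
Proof.
move=> gh t; rewrite [t]matrix_sum_delta !linear_sum; apply: eq_bigr => i _.
rewrite !linear_sum; apply: eq_bigr => j _; rewrite !linearZ.
by rewrite -tens_stdbase gh.
Qed.

End UniversalProperty.

(* A (x) B inside U (x) W; bases suffice as generators, see memv_tensv. *)
Definition tensv (F : fieldType) (U W : vectType F)
    (A : {vspace U}) (B : {vspace W}) : {vspace tensor U W} :=
  <<[seq u \ox w | u <- vbasis A, w <- vbasis B]>>%VS.

Lemma memv_tensv (F : fieldType) (U W : vectType F)
    (A : {vspace U}) (B : {vspace W}) u w :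
  u \in A -> w \in B -> u \ox w \in tensv A B.
Proof.
move=> /coord_vbasis-> /coord_vbasis->.
pose gl w := GRing.isLinear.Build F U (tensor U W) _ _ (@tens_linear_l F U W w).
pose Gl w : {linear U -> tensor U W} := HB.pack (fun u => u \ox w) (gl w).
pose gr u := GRing.isLinear.Build F W (tensor U W) _ _ (@tens_linear_r F U W u).
pose Gr u : {linear W -> tensor U W} := HB.pack (fun w => u \ox w) (gr u).
rewrite -[_ \ox _]/(Gl _ _) linear_sum memv_suml // => i _.
rewrite linearZ memvZ //= -[_ \ox _]/(Gr _ _) linear_sum memv_suml // => j _.
rewrite linearZ memvZ //=; apply/memv_span/allpairsP.
by exists ((vbasis A)`_i, (vbasis B)`_j); rewrite !mem_nth ?size_tuple.
Qed.

Section DoubleBracket.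

Variables (F : fieldType) (V : vectType F).

Definition tensor2 : vectType F := tensor V V.

(* V (x) V (x) V is bracketed to the left. *)
Definition tensor3 : vectType F := tensor tensor2 V.

Definition tassoc : tensor V tensor2 -> tensor3 :=
  tlift (fun (x : V) (t : tensor2) =>
    tlift (fun y z : V => x \ox y \ox z : tensor3) t).

Definition swap : tensor2 -> tensor2 :=
  tlift (fun x y : V => y \ox x : tensor2).

Definition perm12 : tensor3 -> tensor3 :=
  tlift (fun (t : tensor2) (z : V) => swap t \ox z : tensor3).

Definition perm23 : tensor3 -> tensor3 :=
  tlift (fun (t : tensor2) (z : V) =>
    tlift (fun x y : V => x \ox z \ox y : tensor3) t).

Definition double_bracket := 'Hom(tensor2, tensor2).

Variable br : double_bracket.

Definition dbr (a b : V) : tensor2 := br (a \ox b).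

(* dbrL a u = {{a, u}}_L and dbrR a u = {{a, u}}_R, while dbrL' u c is the
   other left extension {{u, c}}_L, with the tensor in the first argument. *)
Definition dbrL (a : V) : tensor2 -> tensor3 :=
  tlift (fun b c : V => dbr a b \ox c : tensor3).

Definition dbrR (a : V) : tensor2 -> tensor3 :=
  tlift (fun b c : V => tassoc (b \ox dbr a c)).

Definition dbrL' (u : tensor2) (c : V) : tensor3 :=
  tlift (fun a b : V => perm23 (dbr a c \ox b)) u.

Lemma swapE x y : swap (x \ox y) = y \ox x.
Proof.
by rewrite /swap tliftE // => [w a u v|u]; rewrite ?tens_linear_r //;
  apply: tens_linear_l.
Qed.

Lemma tassocE x y z : tassoc (x \ox (y \ox z)) = x \ox y \ox z.
Proof.
have E x' y' z' : tlift (fun y z : V => x' \ox y \ox z : tensor3) (y' \ox z')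
    = x' \ox y' \ox z'.
  rewrite tliftE // => [w a u v|u]; last exact: tens_linear_r.
  by rewrite tens_linear_r tens_linear_l.
rewrite /tassoc tliftE // => [t a u v|u]; last exact: tlift_linear.
rewrite /tlift scaler_sumr -big_split; apply: eq_bigr => i _.
rewrite scaler_sumr -big_split; apply: eq_bigr => j _ /=.
by rewrite !tens_linear_l scalerDr !scalerA mulrC.
Qed.

Lemma perm12E x y z : perm12 (x \ox y \ox z) = y \ox x \ox z.
Proof.
rewrite /perm12 tliftE ?swapE // => [w a u v|u]; last exact: tens_linear_r.
by rewrite /swap tlift_linear tens_linear_l.
Qed.

Lemma perm23E x y z : perm23 (x \ox y \ox z) = x \ox z \ox y.
Proof.
have E z' x' y' : tlift (fun x y : V => x \ox z' \ox y : tensor3) (x' \ox y')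
    = x' \ox z' \ox y'.
  rewrite tliftE // => [w a u v|u]; last exact: tens_linear_r.
  by rewrite !tens_linear_l.
rewrite /perm23 tliftE // => [z'|t a u v]; first exact: tlift_linear.
rewrite /tlift scaler_sumr -big_split; apply: eq_bigr => i _.
rewrite scaler_sumr -big_split; apply: eq_bigr => j _ /=.
by rewrite tens_linear_r tens_linear_l scalerDr !scalerA mulrC.
Qed.

Lemma dbrLE a b c : dbrL a (b \ox c) = dbr a b \ox c.
Proof.
rewrite /dbrL tliftE // => [w k u v|u]; last exact: tens_linear_r.
by rewrite /dbr tens_linear_r linearP tens_linear_l.
Qed.

Lemma dbrRE a b c : dbrR a (b \ox c) = tassoc (b \ox dbr a c).
Proof.
rewrite /dbrR tliftE // => [w k u v|t k u v].
  by rewrite tens_linear_l /tassoc tlift_linear.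
by rewrite /dbr tens_linear_r linearP tens_linear_r /tassoc tlift_linear.
Qed.

Lemma dbrL'E a b c : dbrL' (a \ox b) c = perm23 (dbr a c \ox b).
Proof.
rewrite /dbrL' tliftE // => [w k u v|t k u v].
  by rewrite /dbr tens_linear_l linearP tens_linear_l /perm23 tlift_linear.
by rewrite tens_linear_r /perm23 tlift_linear.
Qed.

Definition lambda_double_lie (lambda : F) : Prop :=
  (forall a b : V,
     dbr a b + swap (dbr b a) = lambda *: (a \ox b - b \ox a)) /\
  (forall a b c : V,
     dbrL a (dbr b c) - dbrR b (dbr a c) - dbrL' (dbr a b) c
     = - (lambda *: perm12 (tassoc (b \ox dbr a c)))).

Definition double_ideal (I : {vspace V}) : Prop :=
  (br @: tensv fullv I + br @: tensv I fullv
     <= tensv I fullv + tensv fullv I)%VS.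

Definition double_simple : Prop :=
  (br @: tensv fullv fullv)%VS <> 0%VS /\
  ~ exists I : {vspace V}, [/\ double_ideal I, I <> 0%VS & I <> fullv].

End DoubleBracket.

Arguments lambda_double_lie {F V} br lambda.

(* Main.v *)
(* Pairing the first tensor factor with a functional phi turns {{a, -}} into
   an endomorphism R(a (x) phi) of V, which defines a linear R on End V.  The
   Jacobi identity, after eliminating {{ {{a,b}}, c }}_L by skew-symmetry, says
   exactly that R is a Rota-Baxter operator of weight lambda:
     R x R y = R (R x y + x R y + lambda x y),
   so the images of R and of R' = R + lambda are subalgebras of End V.  A
   subspace stable under either of them is an ideal, hence for simple V both
   act irreducibly, unless one of them vanishes, which skew-symmetry excludes,
   and therefore both contain the identity.  But if R y = 1 = R' u, then
   R u = R y R u = R (u + y (R u + lambda u)) = R u + 1. *)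

Require Import Defs.
From HB Require Import structures.
From mathcomp Require Import all_boot all_order all_algebra ring.

Set Implicit Arguments.
Unset Strict Implicit.
Unset Printing Implicit Defensive.

Import GRing.Theory VectorInternalTheory.

Local Open Scope ring_scope.

(** * Identity elements in matrix algebras, and Rota-Baxter operators *)

Section MatrixAlgebras.

Variables (F : fieldType) (n : nat).

(* Composing [1 - x] with [1 - a], where [a] fixes a nonzero vector of the row
   space of [1 - x], lowers the rank while staying in [1 - P]. *)
Lemma locally_unital_mx1 (P : 'M[F]_n -> Prop) :
    P 0 -> (forall x y, P x -> P y -> P (x + y - x *m y)) ->
    (forall v : 'rV_n, v != 0 -> exists2 a, P a & v *m a = v) ->
  P 1%:M.
Proof.
move=> P0 Pcirc Pfix.
suff Pind r x : P x -> (\rank (1%:M - x)%R <= r)%N -> P 1%:M.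
  exact: Pind P0 (leqnn _).
elim: r x => [|r IHr] x Px.
  by rewrite leqn0 mxrank_eq0 subr_eq0 => /eqP->.
have [/eqP|/rowV0Pn[v vx v0]] := eqVneq (1%:M - x) 0.
  by rewrite subr_eq0 => /eqP->.
have [a Pa va] := Pfix v v0.
move=> rkx; apply: (IHr (x + a - x *m a)); first exact: Pcirc.
have -> : 1%:M - (x + a - x *m a) = (1%:M - x) *m (1%:M - a).
  by rewrite mulmxBr mulmx1 mulmxBl mul1mx -addrA opprD addrA.
rewrite -ltnS; apply: leq_trans rkx.
rewrite -(mxrank_mul_ker (1%:M - x) (1%:M - a)) -addn1 leq_add2l lt0n.
rewrite mxrank_eq0.
apply/rowV0Pn; exists v => //; rewrite sub_capmx vx /=.
by apply/sub_kermxP; rewrite mulmxBr mulmx1 va subrr.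
Qed.

Variables (R : {linear 'M[F]_n -> 'M[F]_n}) (lambda : F).
Hypothesis R_rota_baxter : forall x y,
  R x *m R y = R (R x *m y + x *m R y + lambda *: (x *m y)).

Lemma rota_baxter_no_units y u :
  (0 < n)%N -> R y = 1%:M -> R u + lambda *: u = 1%:M -> False.
Proof.
move=> n_gt0 Ry Ru; have := R_rota_baxter y u.
rewrite Ry !mul1mx -addrA scalemxAr -mulmxDr Ru mulmx1 linearD /= Ry.
move/eqP; rewrite -subr_eq0 opprD addrA subrr add0r oppr_eq0.
by rewrite -mxrank_eq0 mxrank1 => /eqP n0; rewrite n0 in n_gt0.
Qed.

(** The same [z] serves for [R] and [R + lambda]: [R z] is [R x *m R y], and [lambda *: z] supplies
    the other three products. So the image of [R + lambda] is closed under products too. *)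
Lemma rota_baxter_shift x y :
  (R x + lambda *: x) *m (R y + lambda *: y) =
  let z := R x *m y + x *m R y + lambda *: (x *m y) in R z + lambda *: z.
Proof.
rewrite /= -R_rota_baxter mulmxDl !mulmxDr !scalerDr -!scalemxAl -!scalemxAr.
by rewrite !addrA.
Qed.

End MatrixAlgebras.

HB.instance Definition _ (F : fieldType) (U W X : vectType F)
    (f : U -> W -> X) :=
  GRing.isLinear.Build F (tensor U W) X _ (tlift f) (tlift_linear f).

HB.instance Definition _ (F : fieldType) (V : vectType F) :=
  GRing.isLinear.Build F (tensor2 V) (tensor2 V) _ (@swap F V) (tlift_linear _).

Lemma tens_ext3 (F : fieldType) (V X : vectType F)
    (g h : {linear tensor3 V -> X}) :
    (forall x y z : V, g (x \ox y \ox z : tensor3 V) = h (x \ox y \ox z)) ->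
  g =1 h.
Proof.
move=> gh; refine (@tens_ext F (tensor2 V) V X g h _) => t z.
pose tz : {linear tensor2 V -> tensor3 V} := HB.pack
  (fun t : tensor2 V => t \ox z)
  (GRing.isLinear.Build F (tensor2 V) (tensor3 V) _ _ (tens_linear_l z)).
by refine (@tens_ext F V V X (g \o tz) (h \o tz) _ t) => x y; apply: gh.
Qed.

(** * The operator on matrices attached to a double bracket *)

Section DoubleBracketOperator.

Variables (F : fieldType) (V : vectType F) (br : double_bracket V).

Local Notation n := (dim V).

(* [sc i k p l] is the coefficient of {{e_i, e_k}} at e_p (x) e_l. *)
Definition sc (i k p l : 'I_n) : F :=
  (dbr br (stdbase i) (stdbase k) : 'M_(n, n)) p l.

(** The operator R, with matrices acting on row vectors from the right: [delta_mx p i] encodes e_i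
    (x) e_p^*, and its image is the matrix of b |-> (e_p^* (x) id){{e_i, b}}. *)
Definition brop (x : 'M[F]_n) : 'M[F]_n :=
  \matrix_(k, l) \sum_p \sum_i x p i * sc i k p l.

Lemma brop_is_linear : linear brop.
Proof.
move=> a x y; apply/matrixP=> k l; rewrite !mxE mulr_sumr -big_split /=.
apply: eq_bigr => p _; rewrite mulr_sumr -big_split /=; apply: eq_bigr => i _.
by rewrite !mxE mulrDl mulrA.
Qed.

HB.instance Definition _ :=
  GRing.isLinear.Build F 'M[F]_n 'M[F]_n _ brop brop_is_linear.

Lemma brop_delta p i k l : brop (delta_mx p i) k l = sc i k p l.
Proof.
rewrite mxE (bigD1 p) //= (bigD1 i) //= mxE !eqxx mul1r.
rewrite !big1 ?addr0 // => [q /negPf pq|j /negPf ji].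
  by rewrite big1 // => j _; rewrite mxE pq mul0r.
by rewrite mxE eqxx ji mul0r.
Qed.

(** * Coordinates on the triple tensor product *)

(** The rows of a [tensor3] are indexed by ['I_(dim (tensor2 V))], not by pairs; going through
    [tlift] avoids an explicit bijection between the two. *)
Definition coord3 (p q r : 'I_n) : tensor3 V -> F^o :=
  tlift (fun (m : tensor2 V) (z : V) => (m : 'M_(n, n)) p q * v2r z 0 r : F^o).

Lemma coord3_is_linear p q r : linear (coord3 p q r).
Proof. exact: tlift_linear. Qed.

HB.instance Definition _ p q r :=
  GRing.isLinear.Build F (tensor3 V) F^o _ (coord3 p q r)
    (coord3_is_linear p q r).

Lemma coord3E p q r (m : tensor2 V) z :
  coord3 p q r (m \ox z) = (m : 'M_(n, n)) p q * v2r z 0 r.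
Proof.
rewrite /coord3 tliftE // => [w a u v|u a v w].
  by rewrite !mxE mulrDl -mulrA.
by rewrite linearP /= !mxE mulrDr mulrCA.
Qed.

Lemma v2r_stdbase (T : vectType F) (i j : 'I_(dim T)) :
  v2r (stdbase i) 0 j = (i == j)%:R :> F.
Proof. by rewrite /stdbase r2vK mxE eqxx eq_sym. Qed.

Lemma tensE (u w : V) p q :
  (u \ox w : 'M_(n, n)) p q = v2r u 0 p * v2r w 0 q.
Proof. by rewrite /tens mxE big_ord1 mxE. Qed.

Lemma tens_sum (t : tensor2 V) :
  t = \sum_i \sum_j (t : 'M_(n, n)) i j *: (stdbase i \ox stdbase j).
Proof.
rewrite [LHS]matrix_sum_delta; apply: eq_bigr => i _; apply: eq_bigr => j _.
by rewrite tens_stdbase.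
Qed.

Lemma sum_delta_l (f : 'I_n -> F) r : \sum_t f t * (t == r)%:R = f r.
Proof.
rewrite (bigD1 r) //= eqxx mulr1 big1 ?addr0 // => t /negPf->.
by rewrite mulr0.
Qed.

Lemma coord3_assoc p q r x (t : tensor2 V) :
  coord3 p q r (tassoc (x \ox t)) = v2r x 0 p * (t : 'M_(n, n)) q r.
Proof.
pose f := fun (x : V) (t : tensor2 V) =>
  tlift (fun y z : V => x \ox y \ox z : tensor3 V) t.
have fl w : linear (f^~ w).
  move=> a u v; rewrite /f /tlift scaler_sumr -big_split; apply: eq_bigr => i _.
  rewrite scaler_sumr -big_split; apply: eq_bigr => j _ /=.
  by rewrite !tens_linear_l scalerDr !scalerA mulrC.
rewrite /tassoc tliftE //; last by move=> u; apply: tlift_linear.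
rewrite /tlift linear_sum (bigD1 q) //= [X in _ + X]big1 ?addr0; last first.
  move=> i /negPf iq; rewrite linear_sum big1 // => j _.
  by rewrite linearZ /= coord3E tensE v2r_stdbase iq mulr0 mul0r; apply: mulr0.
rewrite linear_sum /= -[X in _ * X]sum_delta_l mulr_sumr.
apply: eq_bigr => j _; rewrite linearZ /= coord3E tensE !v2r_stdbase eqxx mulr1.
by rewrite [LHS]mulrCA.
Qed.

Lemma coord3_perm12 p q r (t : tensor3 V) :
  coord3 p q r (perm12 t) = coord3 q p r t.
Proof.
apply: (tens_ext3 (g := coord3 p q r \o tlift _)) => x y z /=.
by rewrite -/(perm12 _) perm12E !coord3E !tensE [v2r y _ _ * _]mulrC.
Qed.

Lemma coord3_perm23 p q r (t : tensor3 V) :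
  coord3 p q r (perm23 t) = coord3 p r q t.
Proof.
apply: (tens_ext3 (g := coord3 p q r \o tlift _)) => x y z /=.
by rewrite -/(perm23 _) perm23E !coord3E !tensE mulrAC.
Qed.

Lemma coord3_dbrL p q r a (t : tensor2 V) :
  coord3 p q r (dbrL br a t) =
  \sum_s (dbr br a (stdbase s) : 'M_(n, n)) p q * (t : 'M_(n, n)) s r.
Proof.
rewrite /dbrL /tlift linear_sum; apply: eq_bigr => s _; rewrite linear_sum /=.
rewrite -[X in _ * X]sum_delta_l mulr_sumr; apply: eq_bigr => j _.
by rewrite linearZ /= coord3E v2r_stdbase [LHS]mulrCA.
Qed.

Lemma coord3_dbrR p q r b (t : tensor2 V) :
  coord3 p q r (dbrR br b t) =
  \sum_s (t : 'M_(n, n)) p s * (dbr br b (stdbase s) : 'M_(n, n)) q r.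
Proof.
rewrite /dbrR /tlift linear_sum (bigD1 p) //= [X in _ + X]big1 ?addr0 => [|s].
  rewrite linear_sum; apply: eq_bigr => j _.
  by rewrite linearZ /= coord3_assoc v2r_stdbase eqxx mul1r.
move=> /negPf sp; rewrite linear_sum big1 // => j _.
by rewrite linearZ /= coord3_assoc v2r_stdbase sp mul0r; apply: mulr0.
Qed.

Lemma coord3_dbrL' p q r (t : tensor2 V) c :
  coord3 p q r (dbrL' br t c) =
  \sum_s (t : 'M_(n, n)) s q * (dbr br (stdbase s) c : 'M_(n, n)) p r.
Proof.
rewrite /dbrL' /tlift linear_sum; apply: eq_bigr => s _; rewrite linear_sum /=.
rewrite -[X in X * _]sum_delta_l mulr_suml; apply: eq_bigr => j _.
by rewrite linearZ /= coord3_perm23 coord3E v2r_stdbase [RHS]mulrAC -[RHS]mulrA.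
Qed.

(** The matrix [delta_mx p 0 *m v2r a] encodes a (x) e_p^*. Rows of {{a, b}} are thus images of b
    under R, which links stable subspaces to ideals. *)
Lemma dbr_brop a b p l :
  (dbr br a b : 'M_(n, n)) p l = (v2r b *m brop (delta_mx p 0 *m v2r a)) 0 l.
Proof.
rewrite /dbr {1}(tens_sum (a \ox b)) linear_sum summxE mxE.
under [RHS]eq_bigr => k _ do rewrite mxE mulr_sumr.
rewrite [RHS]exchange_big /= [RHS](bigD1 p) //= [X in _ = _ + X]big1 ?addr0;
    last first.
  move=> q /negPf qp; rewrite big1 // => k _; rewrite big1 ?mulr0 // => i _.
  by rewrite mxE big_ord1 mxE qp !mul0r.
under [RHS]eq_bigr => k _ do rewrite mulr_sumr.
rewrite [RHS]exchange_big; apply: eq_bigr => i _ /=.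
rewrite linear_sum summxE; apply: eq_bigr => k _ /=.
by rewrite linearZ mxE tensE mxE big_ord1 mxE !eqxx mul1r mulrA
  [v2r b _ _ * _]mulrC.
Qed.

Lemma memv_tensv_rows (t : tensor2 V) (I : {vspace V}) :
    (forall k, r2v (row k (t : 'M_(n, n))) \in I) ->
  t \in tensv fullv I /\ swap t \in tensv I fullv.
Proof.
move=> tI.
have {1 2}-> : t = \sum_k stdbase k \ox r2v (row k (t : 'M_(n, n))).
  apply/matrixP=> i j; rewrite summxE -[LHS](sum_delta_l (fun k => _ k j)).
  by apply: eq_bigr => k _; rewrite tensE v2r_stdbase r2vK mxE mulrC.
rewrite linear_sum /=; split; apply: memv_suml => k _.
  by rewrite memv_tensv ?memvf.
by rewrite swapE memv_tensv ?memvf.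
Qed.

Lemma swap_coord (t : tensor2 V) p q :
  (swap t : 'M_(n, n)) p q = (t : 'M_(n, n)) q p.
Proof.
rewrite /swap /tlift summxE -[RHS](sum_delta_l (fun i => _ i p)).
apply: eq_bigr => i _; rewrite summxE -[X in _ = X * _]sum_delta_l mulr_suml.
apply: eq_bigr => j _.
by rewrite mxE tensE !v2r_stdbase mulrA.
Qed.

(** * Skew-symmetry, ideals and irreducibility *)

Variable lambda : F.
Hypothesis br_skew : forall a b : V,
  dbr br a b + swap (dbr br b a) = lambda *: (a \ox b - b \ox a).

Lemma sc_skew i j p q :
  sc i j p q + sc j i q p =
  lambda * ((i == p)%:R * (j == q)%:R - (j == p)%:R * (i == q)%:R).
Proof.
have /matrixP/(_ p q) := br_skew (stdbase i) (stdbase j).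
by rewrite mxE swap_coord [RHS]mxE [X in _ * X]mxE [X in _ * (_ + X)]mxE !tensE
  !v2r_stdbase.
Qed.

(** Treats R ([mu = 0]) and R' ([mu = lambda]) uniformly. *)
Definition brshift (mu : F) (x : 'M[F]_n) := brop x + mu *: x.

Lemma brshift_is_linear mu : linear (brshift mu).
Proof.
by move=> a x y; rewrite /brshift linearP !scalerDr !scalerA mulrC addrACA.
Qed.

HB.instance Definition _ mu :=
  GRing.isLinear.Build F 'M[F]_n 'M[F]_n _ (brshift mu) (brshift_is_linear mu).

(** For b in I, every row of {{a, b}} + mu b (x) a is the image of b under some [brshift mu x], so
    this tensor lies in V (x) I. The correction b (x) a lies in I (x) V, and skew-symmetry then
    handles {{b, a}}. *)
Lemma brshift_ideal mu (I : {vspace V}) :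
    (forall b x, b \in I -> r2v (v2r b *m brshift mu x) \in I) ->
  double_ideal br I.
Proof.
move=> invI.
have brI a b : b \in I ->
    dbr br a b \in (tensv I fullv + tensv fullv I)%VS /\
    dbr br b a \in (tensv I fullv + tensv fullv I)%VS.
  move=> bI; pose m : tensor2 V := dbr br a b + mu *: (b \ox a).
  have [mI smI] : m \in tensv fullv I /\ swap m \in tensv I fullv.
    apply: memv_tensv_rows => k.
    suff -> : row k (m : 'M_(n, n)) =
        v2r b *m brshift mu (delta_mx k 0 *m v2r a) by apply: invI.
    apply/rowP=> l; rewrite mxE [LHS]mxE dbr_brop [X in _ + X]mxE tensE.
    rewrite /brshift mulmxDr -scalemxAr [RHS]mxE [X in _ = _ + X]mxE.
    by congr (_ + _ * _); rewrite mulmxA -colE [RHS]mxE big_ord1 [in RHS]mxE.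
  have memL := subvP (addvSl (tensv I fullv) (tensv fullv I)).
  have memR := subvP (addvSr (tensv I fullv) (tensv fullv I)).
  have baI : b \ox a \in tensv I fullv by rewrite memv_tensv ?memvf.
  have abI : a \ox b \in tensv fullv I by rewrite memv_tensv ?memvf.
  have br_ab : dbr br a b = m - mu *: (b \ox a) by rewrite addrK.
  split.
    by rewrite br_ab; apply: memvB; [apply: memR | apply/memvZ/memL].
  have -> : dbr br b a = lambda *: (b \ox a - a \ox b) - swap (dbr br a b).
    by rewrite -br_skew addrK.
  rewrite br_ab [swap (_ - _)]linearB /= [swap (_ *: _)]linearZ /= swapE.
  by apply: memvB; [apply/memvZ/memvB|apply: memvB; [|apply: memvZ]];
    first [exact: memL | exact: memR].
rewrite /double_ideal subv_add !limg_span; apply/andP; split; apply/span_subvP.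
  move=> _ /mapP[_ /allpairsP[[a b] /= [_ bI ->]] ->].
  by have [] := brI a b (vbasis_mem bI).
move=> _ /mapP[_ /allpairsP[[b a] /= [bI _ ->]] ->].
by have [] := brI a b (vbasis_mem bI).
Qed.

(** Let A be the image of [brshift mu], a subalgebra. If A is nonzero, simplicity forces vA = V for
    each nonzero v; hence some element of A fixes v, and [locally_unital_mx1] applies. *)
Lemma simple_brshift_unital mu :
    double_simple br ->
    (forall x y, exists z, brshift mu x *m brshift mu y = brshift mu z) ->
  (forall x, brshift mu x = 0) \/ exists y, brshift mu y = 1%:M.
Proof.
move=> [_ nideal] mulP.
have ideal_full I : double_ideal br I -> I != 0%VS -> I = fullv.
  move=> idI /eqP I0; have [//|/eqP Ifull] := eqVneq I fullv.
  by case: nideal; exists I.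
have [L0|Ln0] := eqVneq (linfun (brshift mu)) 0.
  by left=> x; have := lfunE (brshift mu) x; rewrite L0 zero_lfunE.
right; suff [y ->] : exists y, 1%:M = brshift mu y by exists y.
apply: (locally_unital_mx1 (P := fun m => exists y, m = brshift mu y)).
- by exists 0; rewrite linear0.
- move=> _ _ [x ->] [y ->]; have [z ->] := mulP x y.
  by exists (x + y - z); rewrite (linearB (brshift mu)) (linearD (brshift mu)).
move=> v v0; pose f := linfun (r2v \o mulmx v \o brshift mu) : 'Hom(_, V).
have fE x : f x = r2v (v *m brshift mu x) by rewrite lfunE.
(* If vA = 0, the line through v is stable, hence an ideal, hence all of V; then A kills V,
   contradicting A nonzero. *)
have [f0|fn0] := eqVneq (limg f) 0%VS.
  have vS x : v *m brshift mu x = 0.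
    apply: (can_inj r2vK); rewrite linear0 -fE; apply/eqP.
    by rewrite -memv0 -f0 memv_img ?memvf.
  have fullE : <[r2v v]>%VS = fullv.
    apply: ideal_full.
      apply: (brshift_ideal (mu := mu)) => _ x /vlineP[c ->].
      by rewrite linearZ /= r2vK -scalemxAl vS scaler0 linear0 mem0v.
    by rewrite -subv0 -memvE memv0 -(can_eq v2rK) r2vK linear0.
  case/eqP: Ln0; apply/lfunP=> x; rewrite lfunE zero_lfunE.
  apply/row_matrixP=> i.
  have : r2v (delta_mx 0 i) \in <[r2v v]>%VS by rewrite fullE memvf.
  case/vlineP=> c; rewrite -linearZ => /(can_inj r2vK) delta_v.
  by rewrite rowE delta_v -scalemxAl vS scaler0 row0.
(* Otherwise vA is a nonzero subspace, stable because A is closed under products. *)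
have fullE : limg f = fullv.
  apply: (ideal_full _ _ fn0); apply: (brshift_ideal (mu := mu)) => b x.
  case/memv_imgP=> y _ -> {b}; rewrite fE r2vK -mulmxA.
  by have [z ->] := mulP y x; rewrite -fE memv_img ?memvf.
have /memv_imgP[x _ vE] : r2v v \in limg f by rewrite fullE memvf.
exists (brshift mu x); first by exists x.
by apply: (can_inj r2vK); rewrite -fE.
Qed.

(** * From the Jacobi identity to the Rota-Baxter identity *)

Hypothesis br_jacobi : forall a b c : V,
  dbrL br a (dbr br b c) - dbrR br b (dbr br a c) - dbrL' br (dbr br a b) c
  = - (lambda *: perm12 (tassoc (b \ox dbr br a c))).

Lemma sc_jacobi i j k p q r :
  \sum_s sc i s p q * sc j k s r - \sum_s sc i k p s * sc j s q r
    - \sum_s sc i j s q * sc s k p r = - (lambda * ((j == q)%:R * sc i k p r)).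
Proof.
have /(congr1 (coord3 p q r)) := br_jacobi (stdbase i) (stdbase j) (stdbase k).
rewrite !linearB linearN linearZ /= coord3_dbrL coord3_dbrR coord3_dbrL'.
by rewrite coord3_perm12 coord3_assoc v2r_stdbase.
Qed.

Lemma mulmx_deltar (A : 'M[F]_n) (q j s t : 'I_n) :
  (A *m delta_mx q j) s t = A s q * (t == j)%:R.
Proof.
rewrite mxE (bigD1 q) //= mxE eqxx big1 ?addr0 // => l /negPf lq.
by rewrite mxE lq mulr0.
Qed.

Lemma mulmx_deltal (A : 'M[F]_n) (p i s t : 'I_n) :
  (delta_mx p i *m A) s t = (s == p)%:R * A i t.
Proof.
rewrite mxE (bigD1 i) //= mxE eqxx andbT big1 ?addr0 // => l /negPf li.
by rewrite mxE li andbF mul0r.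
Qed.

Lemma brop_rota_baxter_delta (p i q j : 'I_n)
    (x := delta_mx p i) (y := delta_mx q j) :
  brop x *m brop y = brop (brop x *m y + x *m brop y + lambda *: (x *m y)).
Proof.
apply/matrixP=> k r; rewrite !linearD linearZ /= mul_delta_mx_cond linearMn /=.
rewrite mxE [RHS]mxE [X in _ = X + _]mxE [X in _ = _ + X]mxE mulmxnE brop_delta.
have -> : brop (brop x *m y) k r = \sum_s sc i s p q * sc j k s r.
  rewrite mxE; apply: eq_bigr => s _; rewrite (bigD1 j) //= big1 ?addr0.
    by rewrite mulmx_deltar eqxx mulr1 brop_delta.
  by move=> t /negPf tj; rewrite mulmx_deltar tj mulr0 mul0r.
have -> : brop (x *m brop y) k r = \sum_s sc j i q s * sc s k p r.
  rewrite mxE (bigD1 p) //= [X in _ + X]big1 ?addr0 => [|s /negPf sp].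
    by apply: eq_bigr => s _; rewrite mulmx_deltal eqxx mul1r brop_delta.
  by rewrite big1 // => t _; rewrite mulmx_deltal sp !mul0r.
under eq_bigr => s _ do rewrite !brop_delta.
have := sc_jacobi i j k p q r.
(* Skew-symmetry turns the third Jacobi sum into the entry of [brop (x *m brop y)] plus two lambda
   terms: one cancels the right-hand side of Jacobi, the other is the entry of
   [brop (lambda *: (x *m y))]. *)
have -> : \sum_s sc i j s q * sc s k p r =
    lambda * ((j == q)%:R * sc i k p r - (i == q)%:R * sc j k p r)
      - \sum_s sc j i q s * sc s k p r.
  rewrite -[sc i k p r](sum_delta_l (fun s => sc s k p r)).
  rewrite -[sc j k p r](sum_delta_l (fun s => sc s k p r)).
  rewrite !mulr_sumr -sumrB mulr_sumr -sumrB; apply: eq_bigr => s _.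
  have -> : sc i j s q = lambda * ((i == s)%:R * (j == q)%:R -
      (j == s)%:R * (i == q)%:R) - sc j i q s by rewrite -sc_skew addrK.
  by rewrite [i == s]eq_sym [j == s]eq_sym; ring.
by move/(canRL (subrK _))/(canRL (subrK _))->; ring.
Qed.

Lemma mx_linear_ind (Q : 'M[F]_n -> Prop) :
    Q 0 -> (forall a x y, Q x -> Q y -> Q (a *: x + y)) ->
    (forall i j, Q (delta_mx i j)) ->
  forall x, Q x.
Proof.
move=> Q0 Qlin Qdelta x.
have QD y z : Q y -> Q z -> Q (y + z) by rewrite -{2}[y]scale1r; apply: Qlin.
rewrite [x]matrix_sum_delta; apply: big_ind => // i _; apply: big_ind => // j _.
by rewrite -[_ *: _]addr0; apply: Qlin.
Qed.

Lemma brop_rota_baxter x y :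
  brop x *m brop y = brop (brop x *m y + x *m brop y + lambda *: (x *m y)).
Proof.
elim/mx_linear_ind: x => [|a x1 x2 IH1 IH2|p i].
- by rewrite !(linear0, mul0mx, scaler0, addr0).
- rewrite linearP mulmxDl -scalemxAl /= IH1 IH2 -linearP; congr (brop _).
  rewrite !mulmxDl -!scalemxAl !scalerDr !scalerA [lambda * a]mulrC.
  by rewrite addrACA [X in X + _ = _]addrACA.
elim/mx_linear_ind: y => [|a y1 y2 IH1 IH2|q j].
- by rewrite !(linear0, mulmx0, scaler0, addr0).
- rewrite linearP mulmxDr -scalemxAr /= IH1 IH2 -linearP; congr (brop _).
  rewrite !mulmxDr -!scalemxAr !scalerDr !scalerA [lambda * a]mulrC.
  by rewrite addrACA [X in X + _ = _]addrACA.
exact: brop_rota_baxter_delta.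
Qed.

End DoubleBracketOperator.

Theorem theorem8 (F : fieldType) (lambda : F)
    (char2_lambda : 2%N \in [pchar F] -> lambda = 0)
    (V : vectType F) (br : double_bracket V) :
  lambda_double_lie br lambda -> ~ double_simple br.
Proof.
move=> [br_skew br_jacobi] br_simple.
have brop_neq0 : ~ forall x, brop br x = 0.
  move=> br0; case: br_simple => br_nz _; case: br_nz; apply/eqP.
  rewrite -subv0 limg_span.
  apply/span_subvP=> _ /mapP[_ /allpairsP[[a b] /= [_ _ ->]] ->].
  rewrite memv0; apply/eqP/matrixP=> p l.
  by rewrite -[br _]/(dbr br a b) dbr_brop br0 mulmx0 !mxE.
have n_gt0 : (0 < dim V)%N.
  rewrite lt0n; apply/eqP=> n0; case: brop_neq0 => x.
  by apply/matrixP=> -[k k_lt]; exfalso; rewrite n0 in k_lt.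
have RB := brop_rota_baxter br_skew br_jacobi.
have [x y|br0|[y bry]] := simple_brshift_unital br_skew (mu := 0) br_simple.
- by exists (brop br x *m y + x *m brop br y + lambda *: (x *m y));
    rewrite /brshift !scale0r !addr0 RB.
- by case: brop_neq0 => x; rewrite -(br0 x) /brshift scale0r addr0.
have [x u|br0|[u bru]] :=
    simple_brshift_unital br_skew (mu := lambda) br_simple.
- exact: ex_intro (rota_baxter_shift RB x u).
(* Here R' = 0, that is R = -lambda, and {{e_i, e_i}} has coefficient -lambda at e_i (x) e_i;
   skew-symmetry then gives 2 lambda = 0. *)
- suff l0 : lambda = 0.
    by case: brop_neq0 => x; rewrite -(br0 x) /brshift l0 scale0r addr0.
  (* In characteristic 2 with lambda nonzero this case does occur: {{a, b}} = lambda b (x) a on a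
     one-dimensional space is simple. *)
  have [/char2_lambda//|two_neq0] := boolP (2%N \in [pchar F]).
  pose i := Ordinal n_gt0; have := sc_skew br_skew i i i i.
  rewrite !eqxx subrr mulr0 => /eqP.
  have -> : sc br i i i i = - lambda.
    have /matrixP/(_ i i) := br0 (delta_mx i i).
    rewrite /brshift mxE brop_delta !mxE !eqxx mulr1 => /eqP.
    by rewrite addr_eq0 => /eqP.
  rewrite -mulr2n -mulr_natr mulf_eq0 oppr_eq0 => /orP[]/eqP // two0.
  by case/negP: two_neq0; rewrite inE two0 eqxx.
apply: (rota_baxter_no_units RB n_gt0 _ bru).
by rewrite -bry /brshift scale0r addr0.
Qed.
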